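(* Fix $r \ge 1$ and positive integers $n_1, \dots, n_r$, and fix a label $v = (v_1,\dots,v_r)$ with $1 \le v_i \le n_i$ for all $i$. For each admissible $N$, let $\alpha$ be the number of balls that receive the label $v$ when $N$ balls are labelled by the Second Way. Then the average (expected value) of $\alpha$ is exactly $$\frac{N}{\prod_{i=1}^r n_i},$$ and, as $N \to \infty$ through admissible values, its variance is $$\frac{N}{\prod_{i=1}^r n_i} - \frac{N}{\prod_{i=1}^r n_i^2}\left(n_1 + \sum_{i=2}^r (n_i - 1)\, n_{i-1}\right) + O(1),$$ where the implied constant may depend on $r, n_1, \dots, n_r$ but not on $N$.
   Context: There are $N$ distinguishable balls. A label is an integer vector $(a_1,\dots,a_r)$ with $1 \le a_i \le n_i$ for each $i$. The positive integer $N$ is called admissible if it is divisible by $\mathrm{lcm}(n_1 n_2, n_2 n_3, \dots, n_{r-1} n_r)$ (for $r=1$, admissible means divisible by $n_1$). Second Way (random labelling): at iteration $1$, the $N$ balls are distributed into $n_1$ pots numbered $1, \dots, n_1$, each receiving exactly $N/n_1$ balls, uniformly at random among all $N!/((N/n_1)!)^{n_1}$ such distributions; $a_1$ of a ball is the number of its pot. For $i = 2, \dots, r$, the balls are left in their $n_{i-1}$ pots from iteration $i-1$ (each pot containing $N/n_{i-1}$ balls), and $n_i$ new pots numbered $1,\dots,n_i$, each of capacity $N/n_i$, are lined up. For each of the $n_{i-1}$ old pots separately and independently, its contents are distributed into the $n_i$ new pots so that each new pot receives exactly $N/(n_{i-1} n_i)$ balls from that old pot, uniformly at random among all $(N/n_{i-1})!/((N/(n_{i-1}n_i))!)^{n_i}$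 ways to do so. The component $a_i$ of a ball's label is the number of the new pot into which it falls. Thus all $$\frac{N!}{((N/n_1)!)^{n_1}} \prod_{i=2}^r \left[\frac{(N/n_{i-1})!}{((N/(n_{i-1}n_i))!)^{n_i}}\right]^{n_{i-1}}$$ outcomes of the whole procedure are equally likely. The variance of a random variable $X$ is the expected value of $(X - E[X])^2$. *)

(* Defs.v *)
(* MathComp, with discrete probability over finite types. *)
From mathcomp Require Import all_boot all_order all_algebra.
Set Implicit Arguments.
Unset Strict Implicit.
Unset Printing Implicit Defensive.
Import Order.TTheory GRing.Theory Num.Theory.
Local Open Scope ring_scope.

(* Indices are shifted by one: iterations are 0, ..., r - 1, iteration i has
   n i pots, numbered 0, ..., n i - 1; only the values n 0, ..., n (r - 1) of
   n : nat -> nat are ever used. *)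

Definition admissible (r : nat) (n : nat -> nat) (N : nat) : bool :=
  (0 < N)%N &&
  (if r == 1%N then (n 0 %| N)%N
   else (\big[lcmn/1]_(1 <= i < r) (n i.-1 * n i) %| N)%N).

Definition label (r : nat) (n : nat -> nat) : Type :=
  {dffun forall i : 'I_r, 'I_(n i)}.

(* Full record of a run: w i b is the pot of ball b at iteration i. *)
Definition outcome (N r : nat) (n : nat -> nat) : Type :=
  {dffun forall i : 'I_r, {ffun 'I_N -> 'I_(n i)}}.

(* Distributions of the balls in T into m pots, k balls in each pot. *)
Definition fillings (T : finType) (m k : nat) : {set {ffun T -> 'I_m}} :=
  [set f : {ffun T -> 'I_m} | [forall q, #|[set x | f x == q]| == k]].

Definition unif (R : realFieldType) (T : finType) (A : {set T}) (x : T) : R :=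
  (x \in A)%:R / #|A|%:R.

(* Probability that balls lying in m old pots according to f fall into m' new
   pots according to g: the contents {b | f b == p} of the old pots p are
   distributed independently, each one uniformly. *)
Definition step_prob (R : realFieldType) (N m m' : nat)
    (f : {ffun 'I_N -> 'I_m}) (g : {ffun 'I_N -> 'I_m'}) : R :=
  \prod_(p < m)
    unif R (fillings {b : 'I_N | f b == p} m' (N %/ (m * m')))
      [ffun x : {b : 'I_N | f b == p} => g (val x)].

(* Law of the procedure, as the product over the iterations of the conditional
   probabilities given the previous iteration. For i > 0 the inner product has
   the single factor j = i - 1. *)
Definition second_way (R : realFieldType) (N r : nat) (n : nat -> nat)
    (w : outcome N r n) : R :=
  \prod_(i < r)
    if i == 0 :> nat then unif R (fillings 'I_N (n i) (N %/ n i)) (w i)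
    else \prod_(j < r | j.+1 == i :> nat) step_prob R (w j) (w i).

Definition alpha (N r : nat) (n : nat -> nat) (v : label r n)
    (w : outcome N r n) : nat :=
  #|[set b : 'I_N | [forall i, w i b == v i]]|.

Definition expectation (R : realFieldType) (T : finType) (P X : T -> R) : R :=
  \sum_(w : T) P w * X w.

Definition variance (R : realFieldType) (T : finType) (P X : T -> R) : R :=
  expectation P (fun w => (X w - expectation P X) ^+ 2).

(* Main.v *)
(* By linearity it suffices to find, for a set B of k balls, the probability
   that all of B receives the label v.  Then all of B lies in the same pot at
   every iteration, and a uniform filling treats the s balls of that pot
   symmetrically and sends k' of them to the prescribed new pot: this has
   conditional probability k'^_k / s^_k.  Multiplying over the iterations gives
   the exact factorial moments of alpha; those of order 0, 1, 2 give the mean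
   and the variance, and the second one is expanded in powers of 1/N. *)
Require Import Defs.
From mathcomp Require Import all_boot all_order all_algebra perm ring lra.
Set Implicit Arguments.
Unset Strict Implicit.
Unset Printing Implicit Defensive.
Import Order.TTheory GRing.Theory Num.Theory.
Local Open Scope ring_scope.

(** * Sums over the trajectories of a Markov chain *)

Section Chain.
Variable R : idomainType.
Implicit Types T : nat -> finType.

(* Splitting off the first coordinate shifts the family T by conversion, so no
   cast is needed; splitting off the last one would require casts. *)
Definition dcons r T (x : T 0%N) (w : {dffun forall i : 'I_r, T i.+1}) :
    {dffun forall i : 'I_r.+1, T i} :=
  finfun (fun i : 'I_r.+1 => match i as j return T j with
                   | Ordinal 0 _ => x
                   | Ordinal k.+1 lt_k => w (@Ordinal r k lt_k)
                   end).

Lemma dcons0 r T (x : T 0%N) (w : {dffun forall i : 'I_r, T i.+1}) :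
  dcons x w ord0 = x.
Proof. by rewrite /dcons ffunE. Qed.

Lemma dconsS r T (x : T 0%N) (w : {dffun forall i : 'I_r, T i.+1}) (i : 'I_r) :
  dcons x w (lift ord0 i) = w i.
Proof.
rewrite /dcons ffunE; case: i => k lt_k /=.
move: (lift_subproof _ _) => p.
by rewrite (bool_irrelevance (p : (k < r)%N) lt_k).
Qed.

Lemma sum_dffun_recl r T (F : {dffun forall i : 'I_r.+1, T i} -> R) :
  \sum_w F w =
  \sum_(x : T 0%N) \sum_(w : {dffun forall i : 'I_r, T i.+1}) F (dcons x w).
Proof.
rewrite pair_bigA.
rewrite (reindex (fun p : T 0%N * {dffun forall i : 'I_r, T i.+1} =>
  dcons p.1 p.2)) //.
apply: onW_bij.
exists (fun w : {dffun forall i : 'I_r.+1, T i} => (w ord0 : T 0%N,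
   finfun (fun i : 'I_r => w (lift ord0 i) : T i.+1))) => [[x w]|w].
  congr (_, _); first exact: dcons0.
  by apply/ffunP => i; rewrite ffunE; apply: dconsS.
apply/ffunP => i; case: (unliftP ord0 i) => [j|] -> /=; last exact: dcons0.
by apply: etrans (dconsS _ _ _) _; rewrite ffunE.
Qed.

Lemma big_dffun0 T (F : {dffun forall i : 'I_0, T i} -> R) w0 :
  \sum_w F w = F w0.
Proof.
by apply: big_pred1 => w; apply/esym/eqP/ffunP; case.
Qed.

(** Weight of a trajectory for initial weights [mu 0] and kernels [K j j.+1]. The form copies
    [second_way], so that the two agree by conversion. *)
Definition chain_weight r T (mu : forall i, T i -> R)
    (K : forall i j, T i -> T j -> R) (w : {dffun forall i : 'I_r, T i}) : R :=
  \prod_(i < r)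
    if i == 0 :> nat then mu i (w i)
    else \prod_(j < r | j.+1 == i :> nat) K j i (w j) (w i).

(** Given the first state [x], the rest is again a chain, started from the row [K 0 i.+1 x]; this
    drives the inductions below. *)
Lemma chain_weight_cons r T (mu : forall i, T i -> R)
    (K : forall i j, T i -> T j -> R) (x : T 0%N)
    (w : {dffun forall i : 'I_r, T i.+1}) :
  chain_weight mu K (dcons x w) =
  mu 0%N x * chain_weight (T := fun i => T i.+1)
    (fun i => K 0%N i.+1 x) (fun i j => K i.+1 j.+1) w.
Proof.
rewrite /chain_weight big_ord_recl /= dcons0; congr (_ * _).
apply: eq_bigr => i _.
(* The inner product splits off j = 0, present exactly when the shifted index [bump 0 i] is 1. *)
rewrite big_mkcond big_ord_recl -big_mkcond /= dcons0 dconsS.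
have [i0|i0] /= := eqVneq (i : nat) 0%N.
  have -> : (1%N == bump 0 i) = true by rewrite i0.
  by rewrite big_pred0 ?mulr1 // => j; rewrite i0.
have -> : (1%N == bump 0 i) = false by rewrite eq_sym; apply/negbTE.
by rewrite mul1r; apply: eq_bigr => j _; rewrite dconsS.
Qed.

(** [P] is an invariant kept by all steps of nonzero weight. On [P] the one-step sum is the same
    constant for every state, so the steps factor; the induction peels off the first one and shifts
    all families. *)
Lemma sum_chain_from r T (K : forall i j, T i -> T j -> R)
    (h : forall i, T i -> R) (P : forall i, pred (T i)) (c : nat -> R) :
  (forall i x, (i < r)%N -> P i x -> \sum_y K i i.+1 x y * h i.+1 y = c i) ->
  (forall i x y, (i < r)%N -> P i x -> K i i.+1 x y * h i.+1 y != 0 ->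
     P i.+1 y) ->
  forall x, P 0%N x ->
  \sum_(w : {dffun forall i : 'I_r, T i.+1})
     chain_weight (T := fun i => T i.+1)
       (fun i => K 0%N i.+1 x) (fun i j => K i.+1 j.+1) w *
     \prod_(i < r) h i.+1 (w i) = \prod_(i < r) c i.
Proof.
elim: r T K h P c => [|r IHr] T K h P c sumK PK x Px.
  have w0 : {dffun forall i : 'I_0, T i.+1} by apply: finfun => -[].
  rewrite (big_dffun0 (T := fun i => T i.+1) _ w0).
  by rewrite /chain_weight !big_ord0 mulr1.
rewrite (sum_dffun_recl (T := fun i => T i.+1)) big_ord_recl.
rewrite -(sumK 0%N x) // mulr_suml.
apply: eq_bigr => y _.
have wE (w : {dffun forall i : 'I_r, T i.+2}) :
  chain_weight (T := fun i => T i.+1) (fun i => K 0%N i.+1 x)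
    (fun i j => K i.+1 j.+1) (dcons y w) *
  \prod_(i < r.+1) h i.+1 (dcons (T := fun i => T i.+1) y w i) =
  K 0%N 1%N x y * h 1%N y *
  (chain_weight (T := fun i => T i.+2) (fun i => K 1%N i.+2 y)
     (fun i j => K i.+2 j.+2) w * \prod_(i < r) h i.+2 (w i)).
  rewrite chain_weight_cons big_ord_recl dcons0 mulrACA; congr (_ * (_ * _)).
  by apply: eq_bigr => i _; rewrite dconsS.
under eq_bigr do rewrite wE.
rewrite -mulr_sumr.
(* If the step has weight zero, [P] may fail at [y], but both sides vanish. *)
have [->|nz] := eqVneq (K 0%N 1%N x y * h 1%N y) 0; first by rewrite !mul0r.
congr (_ * _).
apply: (IHr (fun i => T i.+1) (fun i j => K i.+1 j.+1) (fun i => h i.+1)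
  (fun i => P i.+1) (fun i => c i.+1)).
- by move=> i z lt_ir; apply: sumK.
- by move=> i z t lt_ir; apply: PK.
- exact: PK nz.
Qed.

Lemma sum_chain r T (mu : forall i, T i -> R) (K : forall i j, T i -> T j -> R)
    (h : forall i, T i -> R) (P : forall i, pred (T i)) (c : nat -> R) :
  (forall x, mu 0%N x * h 0%N x != 0 -> P 0%N x) ->
  (forall i x, (i < r)%N -> P i x -> \sum_y K i i.+1 x y * h i.+1 y = c i) ->
  (forall i x y, (i < r)%N -> P i x -> K i i.+1 x y * h i.+1 y != 0 ->
     P i.+1 y) ->
  \sum_(w : {dffun forall i : 'I_r.+1, T i})
     chain_weight mu K w * \prod_(i < r.+1) h i (w i) =
  (\sum_x mu 0%N x * h 0%N x) * \prod_(i < r) c i.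
Proof.
move=> Pmu sumK PK; rewrite sum_dffun_recl mulr_suml; apply: eq_bigr => x _.
have wE (w : {dffun forall i : 'I_r, T i.+1}) :
  chain_weight mu K (dcons x w) * \prod_(i < r.+1) h i (dcons x w i) =
  mu 0%N x * h 0%N x *
  (chain_weight (T := fun i => T i.+1) (fun i => K 0%N i.+1 x)
     (fun i j => K i.+1 j.+1) w * \prod_(i < r) h i.+1 (w i)).
  rewrite chain_weight_cons big_ord_recl dcons0 mulrACA; congr (_ * (_ * _)).
  by apply: eq_bigr => i _; rewrite dconsS.
under eq_bigr do rewrite wE.
rewrite -mulr_sumr.
have [->|nz] := eqVneq (mu 0%N x * h 0%N x) 0; first by rewrite !mul0r.
by rewrite (sum_chain_from sumK PK) // Pmu.
Qed.
End Chain.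

(** * Symmetric weights and falling factorials *)

(* The set B is built ball by ball.  Adding b to B' multiplies the left sum by
   (k - #|B'|) / (#|S| - #|B'|): averaging over b in S :\: B' is allowed because
   exchanging two balls of S preserves W. *)
Lemma sum_falling (R : idomainType) (T : finType) m (W : {ffun T -> 'I_m} -> R)
    (S : {set T}) (u k : nat) :
  (forall x y (g : {ffun T -> _}), x \in S -> y \in S ->
     W [ffun z => g (tperm x y z)] = W g) ->
  (forall g, W g != 0 -> #|[set x in S | g x == u :> nat]| = k) ->
  forall B : {set T}, B \subset S ->
  (\sum_g W g * [forall b in B, g b == u :> nat]%:R) * (#|S| ^_ #|B|)%:R =
  (k ^_ #|B|)%:R * \sum_g W g.
Proof.
move=> Winv Wk B; have [j] := ubnP #|B|; elim: j B => // j IHj B.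
have [->|[b bB]] := set_0Vmem B.
  move=> _ _; rewrite cards0 !ffactn0 mulr1 mul1r; apply: eq_bigr => g _.
  suff -> : [forall b in set0, g b == u :> nat] = true by rewrite mulr1.
  by apply/forall_inP => x; rewrite inE.
rewrite ltnS => leBj sBS.
pose B' := B :\ b.
have cardB : #|B| = #|B'|.+1 by rewrite (cardsD1 b) bB.
have sB'S : B' \subset S by rewrite (subset_trans (subD1set _ _)).
have ltB'j : (#|B'| < j)%N by rewrite -cardB.
have bSB' : b \in S :\: B' by rewrite !inE eqxx (subsetP sBS).
have split_all x (g : {ffun T -> 'I_m}) :
    [forall b in x |: B', g b == u :> nat] =
    (g x == u :> nat) && [forall b in B', g b == u :> nat].
  apply/forall_inP/andP => [gu|[gx /forall_inP gu] y].
    split; first by apply: gu; rewrite setU11.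
    by apply/forall_inP => y yB'; apply: gu; rewrite setU1r.
  by case/setU1P => [->|/gu].
have sym x : x \in S :\: B' ->
    \sum_g W g * [forall b in x |: B', g b == u :> nat]%:R =
    \sum_g W g * [forall b in B, g b == u :> nat]%:R.
  move=> xSB'; have [xS bS] : x \in S /\ b \in S.
    by move: xSB' bSB'; rewrite !inE => /andP[_ ->] /andP[_ ->].
  pose s (g : {ffun T -> 'I_m}) := [ffun z => g (tperm x b z)].
  have sK : involutive s.
    by move=> g; apply/ffunP => z; rewrite !ffunE tpermK.
  rewrite (reindex_inj (inv_inj sK)); apply: eq_bigr => g _.
  rewrite /s Winv //; congr (_ * (nat_of_bool _)%:R).
  rewrite -(setD1K bB) !split_all ffunE tpermL; congr (_ && _).
  apply: eq_forallb_in => y yB'; rewrite ffunE tpermD //.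
    by apply: contraTneq yB' => <-; case/setDP: xSB'.
  by apply: contraTneq yB' => <-; case/setDP: bSB'.
have := IHj B' ltB'j sB'S.
rewrite cardB !ffactnSr !natrM => IHB'.
rewrite [LHS]mulrCA (mulrC (k ^_ _)%:R) -[RHS]mulrA -IHB'.
rewrite [RHS]mulrA [RHS]mulrC; congr (_ * _).
have -> : (#|S| - #|B'|)%N = #|S :\: B'| by rewrite cardsD (setIidPr sB'S).
(* Sum over all [x] instead of [b] and exchange: if [g] has nonzero weight and sends [B'] to [u],
   exactly [k - #|B'|] balls of [S :\: B'] also go to [u]. *)
transitivity (\sum_(x in S :\: B')
    \sum_g W g * [forall b in x |: B', g b == u :> nat]%:R).
  by rewrite (eq_bigr _ sym) sumr_const mulr_natr.
rewrite exchange_big mulr_sumr; apply: eq_bigr => g _ /=.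
rewrite -mulr_sumr mulrCA.
have [->|Wg] := eqVneq (W g) 0; first by rewrite !mul0r.
congr (_ * _); under eq_bigr do rewrite split_all.
case: (boolP [forall b in B', g b == u :> nat]) => [gB'|_]; last first.
  by rewrite mulr0 big1 // => x _; rewrite andbF.
rewrite mulr1; under eq_bigr do rewrite andbT.
rewrite -natr_sum; congr (_%:R).
rewrite -(Wk g Wg) -big_mkcondr sum1dep_card.
have sub : B' \subset [set x in S | g x == u :> nat].
  by apply/subsetP => x xB'; rewrite inE (subsetP sB'S) ?(forall_inP gB').
rewrite -[in RHS](setIidPr sub) -cardsD; apply: eq_card => x.
by rewrite !inE andbA.
Qed.

(** * Uniform fillings and one step of the procedure *)

(** The first component of a bijection of [T] with ['I_m * 'I_k] has all fibers of size k. *)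
Lemma fillings_gt0 (T : finType) (m k : nat) :
  #|T| = (m * k)%N -> (0 < #|fillings T m k|)%N.
Proof.
move=> cardT; have eT : #|T| = #|{: 'I_m * 'I_k}| by rewrite card_prod !card_ord.
pose phi (x : T) : 'I_m * 'I_k := enum_val (cast_ord eT (enum_rank x)).
have phi_bij : bijective phi.
  exists (fun y => enum_val (cast_ord (esym eT) (enum_rank y))) => y.
    by rewrite /phi enum_valK cast_ordK enum_rankK.
  by rewrite /phi enum_valK cast_ordKV enum_rankK.
apply/card_gt0P; exists [ffun x => (phi x).1].
rewrite inE; apply/forallP => q.
have -> : [set x | [ffun x => (phi x).1] x == q] = phi @^-1: setX [set q] setT.
  by apply/setP => x; rewrite !inE ffunE andbT.
rewrite on_card_preimset; last exact: onW_bij.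
by rewrite cardsX cards1 mul1n cardsT card_ord.
Qed.

Lemma sum_unif (R : realFieldType) (T : finType) (A : {set T}) :
  (0 < #|A|)%N -> \sum_x unif R A x = 1.
Proof.
move=> A_gt0; rewrite -mulr_suml -natr_sum -big_mkcond sum1_card divff //.
by rewrite pnatr_eq0 -lt0n.
Qed.

Section Step.
Variables (R : realFieldType) (N m m' : nat) (f : {ffun 'I_N -> 'I_m}).

Lemma mem_restr_fillings k (g : {ffun 'I_N -> 'I_m'}) p :
  ([ffun x : {b : 'I_N | f b == p} => g (val x)] \in fillings _ m' k) =
  [forall q, #|[set b | (f b == p) && (g b == q)]| == k].
Proof.
rewrite inE; apply: eq_forallb => q; congr (_ == _).
rewrite -(card_imset _ val_inj); apply: eq_card => b; rewrite [RHS]inE.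
apply/imsetP/andP => [[x]|[fb gb]].
  by rewrite inE ffunE => gx ->; split=> //; exact: (valP x).
by exists (Sub b fb); rewrite // inE ffunE SubK.
Qed.

Lemma step_prob_neq0 (g : {ffun 'I_N -> 'I_m'}) p q :
  step_prob R f g != 0 ->
  #|[set b | (f b == p) && (g b == q)]| = (N %/ (m * m'))%N.
Proof.
move/prodf_neq0 => /(_ p isT); rewrite /unif mem_restr_fillings.
by rewrite mulf_eq0 negb_or pnatr_eq0 eqb0 negbK => /andP[/forallP/(_ q)/eqP].
Qed.

(** The transposition preserves [f], hence all the counts in [mem_restr_fillings]. *)
Lemma step_prob_tperm (g : {ffun 'I_N -> 'I_m'}) x y :
  f x = f y -> step_prob R f [ffun z => g (tperm x y z)] = step_prob R f g.
Proof.
move=> fxy; apply: eq_bigr => p _; rewrite /unif !mem_restr_fillings.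
congr ((nat_of_bool _)%:R / _); apply: eq_forallb => q; congr (_ == _).
rewrite -[RHS](card_preimset _ (@perm_inj _ (tperm x y))).
apply: eq_card => z; rewrite !inE ffunE; congr ((_ == _) && _).
by case: tpermP => [->|->|].
Qed.

(** A map [g] amounts to the family of its restrictions to the old pots, so the sum is the product
    over the pots of the total masses of uniform laws. *)
Lemma sum_step_prob :
  (forall p, #|[set b | f b == p]| = (m' * (N %/ (m * m')))%N) ->
  \sum_(g : {ffun 'I_N -> 'I_m'}) step_prob R f g = 1.
Proof.
move=> card_f.
pose T p : finType := {ffun {b : 'I_N | f b == p} -> 'I_m'}.
pose U p : {ffun T p -> R} :=
  [ffun h => unif R (fillings {b : 'I_N | f b == p} m' (N %/ (m * m'))) h].
pose restr (g : {ffun 'I_N -> 'I_m'}) : fprod T :=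
  fprod_of_fun (fun p => [ffun x : {b : 'I_N | f b == p} => g (val x)] : T p).
pose glue (t : fprod T) : {ffun 'I_N -> 'I_m'} :=
  [ffun b => (t (f b) : {ffun _ -> _}) (Sub b (eqxx (f b)))].
have restrK : cancel restr glue.
  by move=> g; apply/ffunP => b; rewrite ffunE fprodE ffunE SubK.
have glueK : cancel glue restr.
  move=> t; apply/fprodP => p; rewrite fprodE; apply/ffunP => -[b fb].
  rewrite !ffunE /=; move: (fb); rewrite -(eqP fb) => fb'.
  by rewrite (bool_irrelevance fb' (eqxx (f b))).
transitivity (\sum_(t : fprod T) \prod_p U p (t p)).
  rewrite (reindex restr); last by apply: onW_bij; exists glue.
  by apply: eq_bigr => g _; apply: eq_bigr => p _; rewrite fprodE ffunE.
rewrite big_fprod -(bigA_distr_big_dep _ (fun p => untag 0 (U p))) big1 // => p _.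
rewrite -(big_tag (fun p => U p)); under eq_bigr do rewrite ffunE.
apply: sum_unif; apply: fillings_gt0; rewrite card_sig -(card_f p).
by apply: eq_card => b; rewrite !inE.
Qed.

End Step.

(** * Divisibility from admissibility *)

Lemma admissible_dvd_mul r n N i :
  admissible r n N -> (i.+1 < r)%N -> (n i * n i.+1 %| N)%N.
Proof.
case/andP => _; case: eqP => [->|_] //.
rewrite big_add1 big_mkord => /dvdn_biglcmP dvdN lt_ir.
have lt_i : (i < r.-1)%N by case: r lt_ir {dvdN}.
exact: (dvdN (Ordinal lt_i)).
Qed.

(** For r > 1, [n i] divides its product with a neighbour, the left one if i > 0 and the right one
    if i = 0. For r = 1 the definition itself gives [n 0]. *)
Lemma admissible_dvd r n N i :
  admissible r n N -> (i < r)%N -> (n i %| N)%N.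
Proof.
case: i => [|i] adm lt_ir; last first.
  exact: dvdn_trans (dvdn_mull _ (dvdnn _)) (admissible_dvd_mul adm lt_ir).
have [r1|r1] := eqVneq r 1%N; first by case/andP: adm => _; rewrite r1.
apply: dvdn_trans (dvdn_mulr _ (dvdnn _)) (admissible_dvd_mul (i := 0) adm _).
by rewrite ltn_neqAle eq_sym r1.
Qed.

(** * Probability that a set of balls receives a label *)

Section PotProbability.
Variables (R : realFieldType) (N : nat) (B : {set 'I_N}).
Local Notation j := #|B|.

Lemma natr_ffact_neq0 a b : (b <= a)%N -> (a ^_ b)%:R != 0 :> R.
Proof. by rewrite pnatr_eq0 -lt0n ffact_gt0. Qed.

(** [sum_falling] with [S] the set of all balls and k = N / m. *)
Lemma sum_unif_fillings_all m u : (u < m)%N -> (m %| N)%N ->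
  \sum_g unif R (fillings 'I_N m (N %/ m)) g *
    [forall b in B, g b == u :> nat]%:R =
  ((N %/ m) ^_ j)%:R / (N ^_ j)%:R.
Proof.
move=> lt_um dvd_mN.
have := @sum_falling R 'I_N m (unif R (fillings 'I_N m (N %/ m))) setT u
  (N %/ m) _ _ B (subsetT B).
rewrite cardsT card_ord sum_unif ?mulr1 => [H|].
  apply: canRL (mulfK (natr_ffact_neq0 _)) (H _ _).
  - by rewrite -[leqRHS]card_ord max_card.
  - move=> x y g _ _; rewrite /unif; congr ((nat_of_bool _)%:R / _).
    rewrite !inE; apply: eq_forallb => q; congr (_ == _).
    rewrite -[RHS](card_preimset _ (@perm_inj _ (tperm x y))).
    by apply: eq_card => z; rewrite !inE ffunE.
  - move=> g; rewrite /unif mulf_eq0 negb_or pnatr_eq0 eqb0 negbK inE.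
    case/andP => /forallP/(_ (Ordinal lt_um))/eqP <- _.
    by apply: eq_card => z; rewrite !inE.
by apply: fillings_gt0; rewrite card_ord mulnC divnK.
Qed.

Lemma card_fibers m m' (f : {ffun 'I_N -> 'I_m}) :
  (m * m' %| N)%N -> (0 < m)%N -> f \in fillings 'I_N m (N %/ m) ->
  forall p, #|[set b | f b == p]| = (m' * (N %/ (m * m')))%N.
Proof.
move=> dvd_N m_gt0; rewrite inE => /forallP Ff p; rewrite (eqP (Ff p)).
by rewrite -{1}(divnK dvd_N) (mulnC m) mulnA mulnK // mulnC.
Qed.

(** [sum_falling] with [S] the old pot [u], which has N / m balls and contains [B]. The value is the
    same for all such [f], as [sum_chain] requires. *)
Lemma sum_step_prob_all m m' (f : {ffun 'I_N -> 'I_m}) u u' :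
  (u < m)%N -> (u' < m')%N -> (m * m' %| N)%N ->
  f \in fillings 'I_N m (N %/ m) -> [forall b in B, f b == u :> nat] ->
  \sum_(g : {ffun 'I_N -> 'I_m'}) step_prob R f g *
     [forall b in B, g b == u' :> nat]%:R =
  ((N %/ (m * m')) ^_ j)%:R / ((N %/ m) ^_ j)%:R.
Proof.
move=> lt_um lt_um' dvd_N Ff /forall_inP fu.
have m_gt0 : (0 < m)%N by apply: leq_ltn_trans lt_um.
pose S := [set b | f b == Ordinal lt_um].
have cardS : #|S| = (N %/ m)%N.
  by move: Ff; rewrite inE => /forallP/(_ (Ordinal lt_um))/eqP.
have sBS : B \subset S by apply/subsetP => b /fu fb; rewrite inE.
have := @sum_falling R 'I_N m' (step_prob R f) S u' (N %/ (m * m')) _ _ B sBS.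
rewrite sum_step_prob ?mulr1 => [H|]; last exact: card_fibers.
rewrite -cardS.
apply: canRL (mulfK (natr_ffact_neq0 (subset_leq_card sBS))) (H _ _).
- by move=> x y g; rewrite !inE => /eqP fx /eqP fy; rewrite step_prob_tperm ?fx.
- move=> g /(step_prob_neq0 (Ordinal lt_um) (Ordinal lt_um')) <-.
  by apply: eq_card => b; rewrite !inE.
Qed.

(** Each of the m old pots gives N / (m m') balls to every new pot, N / m' in all: balance passes on
    to the next iteration. *)
Lemma step_prob_fillings m m' (f : {ffun 'I_N -> 'I_m}) g :
  (m * m' %| N)%N -> (0 < m')%N -> step_prob R f g != 0 -> 
  g \in fillings 'I_N m' (N %/ m').
Proof.
move=> dvd_N m'_gt0 fg; rewrite inE; apply/forallP => q; apply/eqP.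
rewrite -sum1dep_card (partition_big f predT) //=.
rewrite (eq_bigr (fun=> N %/ (m * m'))%N) => [|p _].
  by rewrite sum_nat_const card_ord -{2}(divnK dvd_N) mulnA mulnK // mulnC.
rewrite sum1dep_card -(step_prob_neq0 p q fg).
by apply: eq_card => b; rewrite !inE andbC.
Qed.

Lemma label_prob r (n : nat -> nat) (u : nat -> nat) :
  (forall i, (i <= r)%N -> (u i < n i)%N) -> admissible r.+1 n N ->
  \sum_(w : outcome N r.+1 n) second_way R w *
     \prod_(i < r.+1) [forall b in B, w i b == u i :> nat]%:R =
  ((N %/ n 0%N) ^_ j)%:R / (N ^_ j)%:R *
  \prod_(i < r)
    (((N %/ (n i * n i.+1)) ^_ j)%:R / ((N %/ n i) ^_ j)%:R).
Proof.
move=> lt_un adm.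
pose T i : finType := {ffun 'I_N -> 'I_(n i)}.
pose h i (g : T i) : R := [forall b in B, g b == u i :> nat]%:R.
(* Invariant: the filling is balanced and puts [B] into the prescribed pot. *)
pose P i : pred (T i) := fun g => (g \in fillings 'I_N (n i) (N %/ n i)) &&
  [forall b in B, g b == u i :> nat].
have nz (b : bool) (x : R) : x * b%:R != 0 -> x != 0 /\ b.
  by rewrite mulf_eq0 negb_or pnatr_eq0 eqb0 negbK => /andP[].
have := @sum_chain R r T (fun i => unif R (fillings 'I_N (n i) (N %/ n i)))
  (fun i k => @step_prob R N (n i) (n k)) h P
  (fun i => ((N %/ (n i * n i.+1)) ^_ j)%:R / ((N %/ n i) ^_ j)%:R).
rewrite sum_unif_fillings_all ?lt_un // ?(admissible_dvd adm) //; apply.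
- move=> g /nz[]; rewrite /unif mulf_eq0 negb_or pnatr_eq0 eqb0 negbK.
  by case/andP => Fg _ ug; apply/andP.
- move=> i f lt_ir /andP[Ff uf].
  by apply: (sum_step_prob_all _ _ _ Ff uf);
    rewrite ?lt_un ?(ltnW lt_ir) ?(admissible_dvd_mul adm).
- move=> i f g lt_ir _ /nz[fg ug]; apply/andP; split=> //.
  by apply: step_prob_fillings fg; rewrite ?(admissible_dvd_mul adm) //
    (leq_ltn_trans _ (lt_un i.+1 _)).
Qed.

End PotProbability.

(** * Factorial moments of [alpha] *)

(** The binomial coefficient of [alpha] over k counts the k-sets of balls all labelled [v]; the
    product of indicators detects these sets. *)
Lemma alpha_ffact (R : realFieldType) N r n (v : label r n) (w : outcome N r n)
    (u : nat -> nat) k :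
  (forall i : 'I_r, u i = v i) ->
  (alpha v w ^_ k)%:R = k`!%:R * \sum_(B : {set 'I_N} | #|B| == k)
    \prod_(i < r) [forall b in B, w i b == u i :> nat]%:R :> R.
Proof.
move=> uv; rewrite -bin_ffact mulnC natrM /alpha -cards_draws; congr (_ * _).
rewrite -sum1_card natr_sum big_mkcond [RHS]big_mkcond; apply: eq_bigr => B _.
rewrite inE andbC; case: (#|B| == k) => //=.
have [/subsetP sB|] := boolP (B \subset _); last first.
  case/subsetPn => b bB; rewrite inE negb_forall => /existsP[i wi].
  apply/esym/eqP; rewrite prodf_seq_eq0; apply/hasP.
  exists i; rewrite ?mem_index_enum //= pnatr_eq0 eqb0.
  by apply/forall_inPn; exists b; rewrite // uv.
rewrite big1 // => i _.
suff -> : [forall b in B, w i b == u i :> nat] = true by [].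
by apply/forall_inP => b /sB; rewrite inE => /forallP/(_ i); rewrite uv.
Qed.

(* If k > N %/ n i then the i-th factor is the junk value 0 / 0 = 0, which is
   correct: a pot of iteration i is then too small to contain k balls. *)
Lemma expectation_alpha_ffact (R : realFieldType) N r n (v : label r.+1 n) k :
  admissible r.+1 n N -> (k <= N)%N ->
  expectation (@second_way R N r.+1 n) (fun w => (alpha v w ^_ k)%:R) =
  ((N %/ n 0%N) ^_ k)%:R *
  \prod_(i < r) (((N %/ (n i * n i.+1)) ^_ k)%:R / ((N %/ n i) ^_ k)%:R).
Proof.
move=> adm le_kN.
pose u i : nat := if insub i is Some j then v j else 0%N.
have uv (i : 'I_r.+1) : u i = v i by rewrite /u valK.
have lt_un i : (i <= r)%N -> (u i < n i)%N.
  by move=> le_ir; have := ltn_ord (v (Ordinal (le_ir : i < r.+1)%N));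
    rewrite -uv.
rewrite /expectation; under eq_bigr do
  rewrite (alpha_ffact R _ _ uv) mulrCA mulr_sumr.
rewrite -mulr_sumr exchange_big /=.
under eq_bigr => B /eqP cB do rewrite (label_prob R B lt_un adm) cB.
(* There are C(N, k) sets [B], and k! C(N, k) = [N ^_ k] cancels the first denominator, nonzero as k
   <= N. *)
rewrite sumr_const -cardsE card_draws card_ord mulrnAr -mulrnAl -mulrnA mulnC.
by rewrite bin_ffact mulrA [X in X * _]mulrCA divff ?mulr1 ?natr_ffact_neq0.
Qed.

Lemma natr_ffact2 (R : nzRingType) k : (k ^_ 2)%:R = k%:R * (k%:R - 1) :> R.
Proof.
by case: k => [|k]; rewrite ?mul0r // ffactnS ffactn1 natrM -natr1 addrK.
Qed.

(** Uses (X - mu)^2 = X (X - 1) + X - 2 mu X + mu^2; the moment of order 0 is the total mass. *)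
Lemma variance_ffact (R : realFieldType) (T : finType) (P : T -> R)
    (X : T -> nat) (mu : R) :
  expectation P (fun w => (X w ^_ 0)%:R) = 1 ->
  expectation P (fun w => (X w)%:R) = mu ->
  variance P (fun w => (X w)%:R) =
  expectation P (fun w => (X w ^_ 2)%:R) + mu - mu ^+ 2.
Proof.
rewrite /variance => E0 E1; rewrite E1.
move: E0 E1; rewrite /expectation => E0 E1.
transitivity (\sum_w (P w * (X w ^_ 2)%:R + P w * (X w)%:R -
  2 * mu * (P w * (X w)%:R) + mu ^+ 2 * (P w * (X w ^_ 0)%:R))).
  by apply: eq_bigr => w _; rewrite natr_ffact2 ffactn0; ring.
by rewrite !big_split /= sumrN -!mulr_sumr E0 E1; ring.
Qed.

(** * First-order expansions in 1 / N *)

Section Expansion.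
Variable R : realFieldType.

(* phi N = 1 - a / N + O(1 / N ^ 2). *)
Definition expansion (phi : nat -> R) (a : R) :=
  exists (C : R) (N0 : nat), forall N : nat, (N0 <= N)%N -> (0 < N)%N ->
    `|phi N - 1 + a / N%:R| <= C / N%:R ^+ 2.

Lemma expansion_linear a : expansion (fun N => 1 - a / N%:R) a.
Proof.
exists 0, 0%N => N _ _.
by rewrite (_ : _ + _ = 0) ?normr0 ?mul0r //; ring.
Qed.

(** The remainder is exactly - m^2 (m' - 1) / (N^2 (1 - m / N)), and 1 - m / N >= 1/2 once N >= 2 m;
    hence the factor 2 in the constant. *)
Lemma expansion_ratio (m m' : nat) :
  expansion (fun N => (1 - (m * m')%:R / N%:R) / (1 - m%:R / N%:R))
            ((m'%:R - 1) * m%:R).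
Proof.
exists (2 * `|m%:R ^+ 2 * (m'%:R - 1)|), (2 * m)%N => N le_mN N_gt0.
have N0 : N%:R > 0 :> R by rewrite ltr0n.
have d_ge : 1 / 2 <= 1 - m%:R / N%:R :> R.
  have : m%:R / N%:R <= 1 / 2 :> R.
    by rewrite ler_pdivrMr // mulrAC ler_pdivlMr // mul1r mulrC -natrM ler_nat.
  lra.
have d0 : 0 < 1 - m%:R / N%:R :> R by lra.
have lt_mN : (m < N)%N.
  rewrite -(@ltr_nat R) -subr_gt0.
  have -> : N%:R - m%:R = (1 - m%:R / N%:R) * N%:R :> R.
    by field; rewrite gt_eqF.
  exact: mulr_gt0.
set d := 1 - _ in d_ge d0 *.
have -> : (1 - (m * m')%:R / N%:R) / d - 1 + (m'%:R - 1) * m%:R / N%:R =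
   - (m%:R ^+ 2 * (m'%:R - 1)) * (d^-1 / N%:R ^+ 2).
  by rewrite natrM /d; field; rewrite subr_eq0 !gt_eqF // ltr_nat.
rewrite normrM normrN -[leRHS]mulrA [leRHS]mulrCA; apply: ler_wpM2l => //.
rewrite ger0_norm; last by rewrite mulr_ge0 ?invr_ge0 ?exprn_ge0 // ltW.
apply: ler_wpM2r; first by rewrite invr_ge0 exprn_ge0 // ltW.
rewrite -[leRHS]invrK lef_pV2 ?posrE ?invr_gt0 //; lra.
Qed.

(** With t = 1 / N, the remainder is (phi - 1 + a t) psi + (1 - a t) (psi - 1 + b t) + a b t^2. *)
Lemma expansionM phi psi a b :
  expansion phi a -> expansion psi b ->
  expansion (fun N => phi N * psi N) (a + b).
Proof.
move=> [C [N1 phiC]] [D [N2 psiD]].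
(* One summand per term of the remainder; 1 + |b| + D bounds |psi| and 1 + |a| bounds |1 - a t|, as
   t <= 1. *)
exists (C * (1 + `|b| + D) + (1 + `|a|) * D + `|a * b|), (maxn N1 N2) => N.
rewrite geq_max => /andP[le1 le2] N_gt0.
have := phiC N le1 N_gt0; have := psiD N le2 N_gt0.
have N1' : 1 <= N%:R :> R by rewrite ler1n.
pose t : R := N%:R^-1.
have t_ge0 : 0 <= t by rewrite invr_ge0 (le_trans _ N1').
have t_le1 : t <= 1 by rewrite invf_le1 // (lt_le_trans _ N1').
rewrite -!exprVn -/t => psi_le phi_le.
have t2 : 0 < t ^+ 2 by rewrite exprn_gt0 // invr_gt0 (lt_le_trans _ N1').
have t21 : t ^+ 2 <= 1 by rewrite expr_le1.
(* The signs of C and D follow from the bounds themselves, since t^2 > 0. *)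
have C_ge0 : 0 <= C by rewrite -(pmulr_lge0 _ t2) (le_trans _ phi_le).
have D_ge0 : 0 <= D by rewrite -(pmulr_lge0 _ t2) (le_trans _ psi_le).
have psi_bound : `|psi N| <= 1 + `|b| + D.
  rewrite (_ : psi N = 1 - b * t + (psi N - 1 + b * t)); last ring.
  apply: le_trans (ler_normD _ _) _; apply: lerD; last first.
    by apply: le_trans psi_le _; rewrite ler_piMr.
  apply: le_trans (ler_normB _ _) _.
  rewrite normr1 lerD2l normrM (ger0_norm t_ge0).
  by rewrite ler_piMr.
have a_bound : `|1 - a * t| <= 1 + `|a|.
  apply: le_trans (ler_normB _ _) _.
  rewrite normr1 lerD2l normrM (ger0_norm t_ge0).
  by rewrite ler_piMr.
rewrite (_ : phi N * psi N - 1 + _ = (phi N - 1 + a * t) * psi N +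
  (1 - a * t) * (psi N - 1 + b * t) + a * b * t ^+ 2); last ring.
apply: le_trans (ler_normD _ _) _; rewrite [leRHS]mulrDl; apply: lerD; last first.
  by rewrite normrM (ger0_norm (ltW t2)).
apply: le_trans (ler_normD _ _) _; rewrite [leRHS]mulrDl !normrM; apply: lerD.
  by rewrite mulrAC; apply: ler_pM.
by rewrite -[leRHS]mulrA; apply: ler_pM.
Qed.

Lemma expansion_prod r (phi : nat -> nat -> R) (a : nat -> R) :
  (forall i, expansion (phi i) (a i)) ->
  expansion (fun N => \prod_(i < r) phi i N) (\sum_(i < r) a i).
Proof.
move=> phia; elim: r => [|r [C [N0 IHr]]].
  by exists 0, 0%N => N _ _; rewrite !big_ord0 subrr !mul0r addr0 normr0.
have [C' [N0' H]] := expansionM (ex_intro _ C (ex_intro _ N0 IHr)) (phia r).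
by exists C', N0' => N; rewrite !big_ord_recr; apply: H.
Qed.

End Expansion.

(** * Mean and variance of [alpha] *)

Theorem proposition2 (R : realFieldType) (r : nat) (n : nat -> nat)
    (hr : (0 < r)%N) (hn : forall i : nat, (i < r)%N -> (0 < n i)%N) :
  (forall (v : label r n) (N : nat), admissible r n N ->
     expectation (@second_way R N r n) (fun w => (alpha v w)%:R)
     = N%:R / \prod_(i < r) (n i)%:R) /\
  (exists (C : R) (N0 : nat), forall (v : label r n) (N : nat),
     (N0 <= N)%N -> admissible r n N ->
     `| variance (@second_way R N r n) (fun w => (alpha v w)%:R)
        - (N%:R / \prod_(i < r) (n i)%:R
           - N%:R / \prod_(i < r) (n i)%:R ^+ 2
             * ((n 0%N)%:R
                + \sum_(1 <= i < r) ((n i)%:R - 1) * (n i.-1)%:R)) | <= C).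
Proof.
case: r hr hn => // r _ hn.
have n_neq0 i : (i < r.+1)%N -> (n i)%:R != 0 :> R.
  by move=> lt_ir; rewrite pnatr_eq0 -lt0n hn.
have N_neq0 N : admissible r.+1 n N -> N%:R != 0 :> R.
  by case/andP; rewrite pnatr_eq0 -lt0n.
have div0 N : admissible r.+1 n N -> (N %/ n 0%N)%:R = N%:R / (n 0%N)%:R :> R.
  by move=> adm; rewrite natf_div ?(admissible_dvd adm).
have divi N (i : 'I_r) : admissible r.+1 n N ->
    (N %/ n i)%:R = N%:R / (n i)%:R :> R.
  by move=> adm; rewrite natf_div ?(admissible_dvd adm) // ltnW // ltnS.
have divM N (i : 'I_r) : admissible r.+1 n N ->
    (N %/ (n i * n i.+1))%:R = N%:R / ((n i)%:R * (n i.+1)%:R) :> R.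
  by move=> adm; rewrite natf_div ?natrM // (admissible_dvd_mul adm) // ltnS.
have mean (v : label r.+1 n) N : admissible r.+1 n N ->
    expectation (@second_way R N r.+1 n) (fun w => (alpha v w)%:R)
      = N%:R / \prod_(i < r.+1) (n i)%:R.
  (* Moment of order 1: the i-th factor reduces to 1 / [n i.+1]. *)
  move=> adm; transitivity (expectation (@second_way R N r.+1 n)
    (fun w => (alpha v w ^_ 1)%:R)).
    by apply: eq_bigr => w _; rewrite ffactn1.
  rewrite expectation_alpha_ffact //; last by case/andP: adm.
  rewrite ffactn1 div0 // big_ord_recl invfM mulrA; congr (_ * _).
  rewrite -prodfV; apply: eq_bigr => i _.
  rewrite !ffactn1 divM // divi // lift0.
  have b0 := n_neq0 i (ltnW (ltn_ord i)).
  have a0 := n_neq0 i.+1 (ltn_ord i).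
  by field; rewrite a0 b0 N_neq0.
split=> //.
(* For N >= 2, [phi N] is the moment of order 2 divided by the squared mean; [A] collects the
   coefficients of -1 / N in its factors. *)
pose phi N : R := (1 - (n 0%N)%:R / N%:R) *
  \prod_(i < r) ((1 - (n i * n i.+1)%:R / N%:R) / (1 - (n i)%:R / N%:R)).
pose A : R := (n 0%N)%:R + \sum_(i < r) ((n i.+1)%:R - 1) * (n i)%:R.
have [C [N0 phiA]] : expansion phi A.
  apply: expansionM; first exact: expansion_linear.
  exact: (expansion_prod r (fun i => expansion_ratio R (n i) (n i.+1))).
set P := \prod_(i < r.+1) (n i)%:R.
(* The bound C / N^2 for [phi] gets multiplied by (N / P)^2. The moment of order 2 is computed for N
   >= 2. *)
exists (C / P ^+ 2), (maxn 2 N0) => v N; rewrite geq_max => /andP[le2N leN0N] adm.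
have N_gt0 : (0 < N)%N by case/andP: adm.
have E2 : expectation (@second_way R N r.+1 n) (fun w => (alpha v w ^_ 2)%:R)
    = (N%:R / P) ^+ 2 * phi N.
  (* The squares y^2 combine to the squared mean, the factors 1 - 1 / y to [phi]. *)
  have sq (y : R) : y != 0 -> y * (y - 1) = y ^+ 2 * (1 - y^-1).
    by move=> y0; field.
  rewrite expectation_alpha_ffact // natr_ffact2 div0 // sq; last first.
    by rewrite mulf_neq0 ?invr_neq0 ?n_neq0 ?(N_neq0 N adm).
  rewrite invf_div /P big_ord_recl invfM (mulrA N%:R) [in RHS]exprMn /phi.
  rewrite [RHS]mulrACA; congr (_ * _).
  rewrite -prodfV -prodrXl -big_split; apply: eq_bigr => i _ /=.
  rewrite !natr_ffact2 divM // divi // natrM /bump leq0n add1n.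
  have a0 := n_neq0 i.+1 (ltn_ord i).
  have b0 := n_neq0 i (ltnW (ltn_ord i)).
  have x0 := N_neq0 N adm.
  rewrite sq ?(sq (N%:R / (n i)%:R)); last 2 first.
  - by rewrite mulf_neq0 ?invr_neq0.
  - by rewrite mulf_neq0 ?invr_neq0 // mulf_neq0.
  (* The denominator 1 - [n i] / N vanishes when N = [n i]; [mulf_div], valid for zero denominators
     too, separates it off before [field]. *)
  rewrite !invf_div -mulf_div; congr (_ * _).
  by field; rewrite a0 b0 x0.
have E0 : expectation (@second_way R N r.+1 n) (fun w => (alpha v w ^_ 0)%:R) = 1.
  rewrite expectation_alpha_ffact // big1 ?mulr1 // => i _.
  by rewrite !ffactn0 divr1.
rewrite (variance_ffact E0 (mean v N adm)) E2 big_add1 big_mkord -/P.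
rewrite prodrXl -/P -/A.
have Nr0 := N_neq0 N adm.
have P0 : P != 0 by apply/prodf_neq0 => i _; apply: n_neq0.
(* The squared mean and the claimed correction are the terms -1 and A / N of the expansion, scaled
   by (N / P)^2. *)
rewrite (_ : _ - _ = (N%:R / P) ^+ 2 * (phi N - 1 + A / N%:R)); last first.
  by field; rewrite ?Nr0 P0.
rewrite normrM ger0_norm ?sqr_ge0 //.
apply: le_trans (ler_wpM2l (sqr_ge0 _) (phiA N leN0N N_gt0)) _.
by rewrite le_eqVlt; apply/orP; left; apply/eqP; field; rewrite ?Nr0 P0.
Qed.
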